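(* Let $X\neq L^\infty$ be a rearrangement invariant (r.i.) space on $[0,1]$. Suppose that $\Lambda(\varphi)\subseteq X$ for some increasing, concave function $\varphi\colon[0,1]\to[0,\infty)$, not identically zero, satisfying $\varphi(0)=0=\lim_{t\to0^+}\varphi(t)$ and $$\int_0^1\log(1/t)\,\varphi'(t)\,dt<\infty,$$ that is, $\log(1/t)\in\Lambda(\varphi)$. Then $m_X$ has finite variation. In particular, this is the case if $L^p_{\rm exp}\subseteq X$ for some $0<p<1$.
   Context: $\lambda$ is Lebesgue measure on $[0,1]$, $\mathcal{M}$ the $\sigma$-algebra of Lebesgue measurable subsets of $[0,1]$, $f^*$ the decreasing rearrangement of a measurable function $f$ on $[0,1]$ (right-continuous inverse of $\tau\mapsto\lambda(\{|f|>\tau\})$). Functions are real-valued. A Banach function space (B.f.s.) $X$ on $[0,1]$ is a Banach space of ($\lambda$-a.e. classes of) measurable functions on $[0,1]$ such that $g\in X$ and $\|g\|_X\le\|f\|_X$ whenever $f\in X$ and $|g|\le|f|$ a.e. A r.i. space is a B.f.s. on $[0,1]$ such that if $g^*\le f^*$ and $f\in X$ then $g\in X$ and $\|g\|_X\le\|f\|_X$. Every r.i. space satisfies $L^\infty\subseteq X\subseteq L^1$. The Fatou property is not assumed. The Lorentz space $\Lambda(\varphi)$ consists of all measurable $f$ with $\|f\|_{\Lambda(\varphi)}:=\int_0^1 f^*(s)\,d\varphi(s)<\infty$. The Zygmund space of exponential integrability $L^p_{\rm exp}$ ($p>0$) consists of all measurable $f$ on $[0,1]$ with $\int_0^1\exp(c|f(t)|^p)\,dt<\infty$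 for some $c>0$; equivalently $\sup_{0<t\le1}\log^{-1/p}(e/t)\,f^*(t)<\infty$. The Cesàro operator is $\mathcal{C}(f)(x):=\frac1x\int_0^x f(t)\,dt$, and $m_X\colon\mathcal{M}\to X$ is the ($\sigma$-additive) vector measure $m_X(A):=\mathcal{C}(\chi_A)$. Its variation is $|m_X|(A)=\sup\sum_i\|m_X(A_i)\|_X$, the supremum over finite measurable partitions $(A_i)$ of $A$; $m_X$ has finite variation if $|m_X|([0,1])<\infty$. *)

(* Defs.v *)
From HB Require Import structures.
From mathcomp Require Import all_boot all_order all_algebra.
From mathcomp Require Import all_classical all_reals all_analysis.

Set Implicit Arguments.
Unset Strict Implicit.
Unset Printing Implicit Defensive.

Import Order.TTheory GRing.Theory Num.Theory.
Import numFieldNormedType.Exports.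

Local Open Scope classical_set_scope.
Local Open Scope ring_scope.

(* The real line with the sigma-algebra of Lebesgue (not only Borel)
   measurable sets, i.e. the domain of [completed_lebesgue_measure]. *)
Notation lebR R := (caratheodory_type ((wlength (@idfun R))^*)%mu).

Definition leb (R : realType) : {measure set (lebR R) -> \bar R} :=
  @completed_lebesgue_measure R.
Arguments leb : clear implicits.

Definition I01 (R : realType) : set (lebR R) := `[0, 1]%classic.
Arguments I01 : clear implicits.

(* A function on [0, 1] is represented by a function R -> R whose values
   outside [0, 1] are irrelevant. *)
Definition mfun01 (R : realType) (f : R -> R) : Prop :=
  measurable_fun (I01 R) (f : lebR R -> R).

Definition ae_eq01 (R : realType) (f g : R -> R) : Prop :=
  ae_eq (leb R) (I01 R) (f : lebR R -> R) g.

(* |g| <= |f| a.e. on [0, 1] *)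
Definition ae_dom01 (R : realType) (g f : R -> R) : Prop :=
  \forall t \ae leb R, I01 R t -> `|g t| <= `|f t|.

(* A Banach space of a.e. classes of measurable functions on [0, 1]: the
   map [bfs_fun] chooses a representative of each element, so that it is linear
   and injective only up to a.e. equality. *)
Record bfs (R : realType) := Bfs {
  bfs_sort :> completeNormedModType R ;
  bfs_fun : bfs_sort -> R -> R ;
  bfs_measurable : forall x, mfun01 (bfs_fun x) ;
  bfs_linear : forall (a : R) x y, ae_eq01 (bfs_fun (a *: x + y))
    (fun t => a * bfs_fun x t + bfs_fun y t) ;
  bfs_inj : forall x y, ae_eq01 (bfs_fun x) (bfs_fun y) -> x = y ;
  bfs_ideal : forall x (g : R -> R), mfun01 g -> ae_dom01 g (bfs_fun x) ->
    exists2 y, ae_eq01 (bfs_fun y) g & `|y| <= `|x| }.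

Definition bfs_set (R : realType) (X : bfs R) : set (R -> R) :=
  [set f | mfun01 f /\ exists x : X, ae_eq01 (bfs_fun x) f].

(* The norm in X of the class of f; +oo when f does not belong to X. There is at
   most one x to take the infimum over. *)
Definition bfs_norm (R : realType) (X : bfs R) (f : R -> R) : \bar R :=
  ereal_inf [set `|x|%:E | x in [set x : X | ae_eq01 (bfs_fun x) f]].

Definition distribution01 (R : realType) (f : R -> R) (tau : R) : \bar R :=
  leb R [set t | I01 R t /\ tau < `|f t|].

(* Extended-valued since f^*(0) is the essential supremum of |f|. *)
Definition rearrangement (R : realType) (f : R -> R) (s : R) : \bar R :=
  ereal_inf [set tau%:E | tau in
    [set tau : R | 0 <= tau /\ (distribution01 f tau <= s%:E)%E]].

Definition rearrangement_invariant (R : realType) (X : bfs R) : Prop :=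
  forall f g : R -> R, mfun01 g -> bfs_set X f ->
    (forall s, s \in `[0, 1] -> (rearrangement g s <= rearrangement f s)%E) ->
  bfs_set X g /\ (bfs_norm X g <= bfs_norm X f)%E.

Definition Linfty (R : realType) : set (R -> R) :=
  [set f | mfun01 f /\
    exists M : R, \forall t \ae leb R, I01 R t -> `|f t| <= M].
Arguments Linfty : clear implicits.

(* Concavity of f on [0, 1] is convexity of - f. *)
Record lorentz_weight (R : realType) := LorentzWeight {
  weight :> R -> R ;
  weight_ge0 : forall t, t \in `[0, 1] -> 0 <= weight t ;
  weight_nd : {in `[0, 1] &, {homo weight : s t / s <= t}} ;
  weight_concave :
    convex_function (`[0, 1]%classic : set R) (fun t : R => - weight t) ;
  weight0 : weight 0 = 0 ;
  weight_cvg0 : weight t @[t --> 0^'+] --> 0 ;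
  weight_neq0 : exists2 t, t \in `[0, 1] & weight t != 0 }.

(* Constant extension of the weight outside [0, 1], needed to form its
   Lebesgue-Stieltjes measure on the line. *)
Definition weight_ext (R : realType) (phi : lorentz_weight R) (t : R) : R :=
  phi (Num.min 1 (Num.max 0 t)).

Section weight_ext_cumulative.
Context (R : realType) (phi : lorentz_weight R).

Lemma clamp01 (t : R) : Num.min 1 (Num.max 0 t) \in `[0, 1].
Proof.
by rewrite in_itv/= le_min ler01 le_max lexx/= ge_min lexx.
Qed.

Lemma clamp01_id (t : R) : t \in `[0, 1] -> Num.min 1 (Num.max 0 t) = t.
Proof. by rewrite in_itv/= => /andP[t0 t1]; rewrite max_r// min_r. Qed.

Lemma weight_ext_nd : nondecreasing (weight_ext phi).
Proof.
move=> s t st; apply: weight_nd; rewrite ?clamp01//.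
by rewrite le_min !ge_min lexx/= ge_max !le_max lexx/= st !orbT.
Qed.

Lemma weight_chord (s t : R) : 0 < s -> s <= t -> t <= 1 ->
  phi t <= t / s * phi s.
Proof.
move=> s0 st t1; have t0 : 0 < t by exact: lt_le_trans st.
have l01 : 0 <= s / t <= 1.
  by rewrite ler_pdivrMr// mul1r st andbT divr_ge0// ltW.
have [l0 l1] := andP l01.
have : - phi (s / t * t + (1 - s / t) * 0) <=
    s / t * - phi t + (1 - s / t) * - phi 0.
  by apply: (@weight_concave _ phi (Itv01 l0 l1) t 0);
    rewrite inE/= in_itv/= ?lexx ?ler01 ?t1 ?(ltW t0).
rewrite weight0 !(mulr0, addr0, oppr0) mulfVK ?gt_eqF// mulrN lerN2.
by rewrite mulrAC ler_pdivrMr// mulrAC ler_pdivlMr// mulrC (mulrC t).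
Qed.

Lemma weight_ext_rc (t : R) :
  weight_ext phi x @[x --> t^'+] --> weight_ext phi t.
Proof.
have [t0|t0] := ltP t 0.
  apply: cvg_near_cst; near=> x.
  have x0 : x < 0 by near: x; exact: nbhs_right_lt.
  by rewrite /weight_ext !max_l ?ltW.
have [t1|t1] := leP 1 t.
  apply: cvg_near_cst; near=> x.
  have x1 : 1 <= x.
    by rewrite (le_trans t1)// ltW//; near: x; exact: nbhs_right_gt.
  by rewrite /weight_ext !min_l// le_max ?t1 ?x1 orbT.
have extE x : x \in `[0, 1] -> weight_ext phi x = phi x.
  by move=> x01; rewrite /weight_ext clamp01_id.
have tI : t \in `[0, 1] by rewrite in_itv/= t0 ltW.
move: t0; rewrite le_eqVlt => /predU1P[t0|t0].
  have ext0 : weight_ext phi 0 = 0.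
    by rewrite extE ?weight0// in_itv/= lexx ler01.
  rewrite -t0 ext0.
  apply: cvg_trans (@weight_cvg0 _ phi); apply: near_eq_cvg; near=> x.
  have x0 : 0 < x by near: x; exact: nbhs_right_gt.
  have x1 : x < 1 by near: x; exact: nbhs_right_lt.
  by rewrite extE// in_itv/= !ltW.
rewrite (extE _ tI).
apply: (@squeeze_cvgr _ _ _ _ (cst (phi t)) (fun x => x / t * phi t)).
- near=> x.
  have tx : t <= x by rewrite ltW//; near: x; exact: nbhs_right_gt.
  have x1 : x <= 1 by rewrite ltW//; near: x; exact: nbhs_right_lt.
  have xI : x \in `[0, 1] by rewrite in_itv/= x1 (le_trans (ltW t0)).
  by rewrite extE//= weight_nd//= weight_chord.
- exact: cvg_cst.
- have {2}-> : phi t = t / t * phi t by rewrite mulfV ?gt_eqF// mul1r.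
  apply: cvgMr_tmp; apply: cvgMr_tmp; apply: cvg_within_filter; exact: cvg_id.
Unshelve. all: by end_near. Qed.

HB.instance Definition _ :=
  isCumulative.Build R _ R (weight_ext phi) weight_ext_nd weight_ext_rc.

End weight_ext_cumulative.

(* The Lebesgue-Stieltjes integral of f^* over [0, 1] with respect to phi. *)
Definition lorentz_norm (R : realType) (phi : lorentz_weight R) (f : R -> R) :
    \bar R :=
  (\int[lebesgue_stieltjes_measure (weight_ext phi)]_(s in `[0%R, 1%R])
     rearrangement f s)%E.

Definition lorentz (R : realType) (phi : lorentz_weight R) : set (R -> R) :=
  [set f | mfun01 f /\ (lorentz_norm phi f < +oo)%E].

Definition Lexp (R : realType) (p : R) : set (R -> R) :=
  [set f | mfun01 f /\ exists2 c : R, 0 < c &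
    (\int[leb R]_(t in I01 R) (expR (c * `|f t| `^ p))%:E < +oo)%E].
Arguments Lexp : clear implicits.

Definition cesaro (R : realType) (f : R -> R) (x : R) : R :=
  x^-1 * \int[leb R]_(t in `[0, x]) f t.

(* m_X(A); the space X only enters through the norm used in [variation]. *)
Definition cesaro_measure (R : realType) (A : set (lebR R)) : R -> R :=
  cesaro (\1_A : R -> R).

Definition measurable_partition (R : realType) (A : set (lebR R)) (n : nat)
    (P : 'I_n -> set (lebR R)) : Prop :=
  [/\ forall i, measurable (P i), trivIset setT P &
      \big[setU/set0]_(i < n) P i = A].

(* By the convention on [bfs_norm], a set function taking a value outside of X
   on some measurable subset of A has infinite variation on A. *)
Definition variation (R : realType) (X : bfs R)
    (m : set (lebR R) -> R -> R) (A : set (lebR R)) : \bar R :=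
  ereal_sup [set v | exists (n : nat) (P : 'I_n -> set (lebR R)),
    measurable_partition A P /\ v = (\sum_(i < n) bfs_norm X (m (P i)))%E].

Definition finite_variation (R : realType) (X : bfs R)
    (m : set (lebR R) -> R -> R) : Prop :=
  (variation X m (I01 R) < +oo)%E.

(* Main.v *)
Require Import Defs.
From mathcomp Require Import all_boot all_order all_algebra.
From mathcomp Require Import all_classical all_reals all_analysis.
From mathcomp Require Import measurable_realfun.
From mathcomp Require Import ring lra.

Set Implicit Arguments.
Unset Strict Implicit.
Unset Printing Implicit Defensive.

Import Order.TTheory GRing.Theory Num.Theory.
Import numFieldNormedType.Exports.

Local Open Scope classical_set_scope.
Local Open Scope ring_scope.

(* Split ]0, 1] into the blocks ]e^-(k+1), e^-k]. On the k-th block C(1_A) is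
   at most sum_(j <= k) e^(j+1) lambda(A & [0, e^-j]), a quantity that is
   additive in A, nondecreasing in k and equal to e(k+1), i.e. of the order of
   log(1/x), for A = [0, 1]. So C(1_A) is dominated by a decreasing step
   function whose weighted sums are additive in A. If a weighted sum being
   finite forces a step function into X, then a gliding hump argument bounds the
   norm in X by a multiple of the weighted sum, and the variation is at most a
   multiple of the weighted sum of k+1. For the Lorentz space the weights are
   the increments of phi over the blocks; for L^p_exp they are 2^-n, put on the
   blocks of index about 2^(pn). *)

(** * Logarithmic step functions and measurability *)

(** Since [ln] is 0 at nonpositive arguments, the index of 0 is 0, so the step functions below are
    monotone only on ]0, 1]; the point 0 is treated apart. *)
Definition log_index (R : realType) (x : R) : nat := Num.truncn (- ln x).

Definition log_step (R : realType) (H : nat -> R) (x : R) : R :=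
  H (log_index x).

(** Both measures are the same outer measure, viewed on different sigma-algebras. *)
Lemma leb_lebesgue (R : realType) (A : set R) : leb R A = lebesgue_measure A.
Proof. by []. Qed.

Lemma measurable_leb (R : realType) (A : set R) :
  measurable (A : set (measurableTypeR R)) -> measurable (A : set (lebR R)).
Proof. exact: sub_caratheodory. Qed.

Lemma measurable_leb_itv (R : realType) (i : interval R) :
  measurable ([set` i] : set (lebR R)).
Proof. apply: measurable_leb; exact: measurable_itv. Qed.

Lemma leb_itv0 (R : realType) (x : R) : 0 <= x -> leb R `[0, x]%classic = x%:E.
Proof.
move=> x0; rewrite leb_lebesgue lebesgue_measure_itv/= lte_fin sube0.
by case: ltgtP x0 => // <-.
Qed.

Lemma borel_mfun01 (R : realType) (f : R -> R) :
  measurable_fun setT f -> mfun01 f.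
Proof.
move=> mf mI Y mY; apply: measurable_leb; apply: measurableI.
  exact: measurable_itv.
by rewrite -[X in measurable X]setTI; exact: mf.
Qed.

Lemma mfun01_log_step (R : realType) (H : nat -> R) :
  nondecreasing_seq H -> mfun01 (log_step H).
Proof.
move=> ndH; apply: borel_mfun01.
rewrite (_ : log_step H = (fun y => H (Num.truncn y)) \o (fun x => - ln x))//.
apply: measurableT_comp.
  apply: nondecreasing_measurable => // x y xy.
  by apply: ndH; exact: le_truncn.
by apply: measurable_funN; exact: measurable_ln.
Qed.

(** * The Cesaro measure and its step majorant *)

Lemma cesaro_measureE (R : realType) (A : set (lebR R)) (x : R) :
  measurable A ->
  cesaro_measure A x = x^-1 * fine (leb R (A `&` `[0, x]%classic)).
Proof.
move=> mA; rewrite /cesaro_measure /cesaro /Rintegral.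
congr (_ * fine _).
by rewrite (integral_indic (leb R) (measurable_leb_itv `[0, x]) mA).
Qed.

Lemma leb_capI_le (R : realType) (A : set (lebR R)) (x : R) :
  measurable A -> 0 <= x -> (leb R (A `&` `[0%R, x]%classic) <= x%:E)%E.
Proof.
move=> mA x0; rewrite -(leb_itv0 x0); apply: le_measure; rewrite ?inE//.
- by apply: measurableI => //; exact: measurable_leb_itv.
- exact: measurable_leb_itv.
Qed.

Lemma leb_capI_fin (R : realType) (A : set (lebR R)) (x : R) :
  measurable A -> (leb R (A `&` `[0%R, x]%classic) \is a fin_num)%E.
Proof.
move=> mA; have [x0|x0] := leP 0 x.
  rewrite ge0_fin_numE//; exact: le_lt_trans (leb_capI_le mA x0) (ltry _).
by rewrite set_itv_ge ?setI0 ?measure0// bnd_simp -ltNge.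
Qed.

Lemma mfun01_cesaro_measure (R : realType) (A : set (lebR R)) :
  measurable A -> mfun01 (cesaro_measure A).
Proof.
move=> mA.
(* The inverse is replaced by a real power, which is measurable on the whole line; they agree on
   [0, 1], both being 0 at 0. The other factor is monotone in [x]. *)
apply: (eq_measurable_fun
  (fun x : lebR R => x `^ (-1) * fine (leb R (A `&` `[0, x]%classic)))).
  move=> x; rewrite inE /I01/= in_itv/= => /andP[x0 _].
  by rewrite cesaro_measureE// powR_inv1.
apply: borel_mfun01.
apply: measurable_funM.
  exact: measurable_powR.
apply: nondecreasing_measurable => // x y xy.
apply: fine_le; rewrite ?leb_capI_fin//.
apply: le_measure; rewrite ?inE.
- by apply: measurableI => //; exact: measurable_leb_itv.
- by apply: measurableI => //; exact: measurable_leb_itv.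
- by apply: setIS; apply: subset_itvl; rewrite bnd_simp.
Qed.

Lemma log_index_bounds (R : realType) (x : R) (k : nat) :
  0 < x -> x <= 1 -> (log_index x == k) =
  (expR (- k.+1%:R) < x <= expR (- k%:R)).
Proof.
move=> x0 x1; rewrite /log_index truncn_eq ?oppr_ge0 ?ln_le0//.
rewrite andbC; congr andb.
  by rewrite -[in RHS](lnK x0) ltr_expR ltrNl.
by rewrite -[in RHS](lnK x0) ler_expR lerNr.
Qed.

Definition cesaro_majorant (R : realType) (A : set (lebR R)) (k : nat) : R :=
  \sum_(j < k.+1)
    expR j.+1%:R * fine (leb R (A `&` `[0, expR (- j%:R)]%classic)).

Lemma cesaro_majorant_ge0 (R : realType) (A : set (lebR R)) k :
  0 <= cesaro_majorant A k.
Proof. by apply: sumr_ge0 => j _; rewrite mulr_ge0 ?expR_ge0 ?fine_ge0. Qed.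

Lemma cesaro_majorant_nd (R : realType) (A : set (lebR R)) :
  nondecreasing_seq (cesaro_majorant A).
Proof.
apply/nondecreasing_seqP => k; rewrite {2}/cesaro_majorant big_ord_recr/=.
by rewrite lerDl mulr_ge0 ?expR_ge0 ?fine_ge0.
Qed.

Lemma cesaro_measure_le_majorant (R : realType) (A : set (lebR R)) (x : R) :
  measurable A -> x \in `[0, 1] ->
  `|cesaro_measure A x| <= `|log_step (cesaro_majorant A) x|.
Proof.
move=> mA; rewrite in_itv/= le_eqVlt => /andP[/predU1P[<-|x0] x1].
  (* At 0 the convention [0^-1 = 0] makes the left-hand side vanish. *)
  by rewrite cesaro_measureE// invr0 mul0r normr0 normr_ge0.
rewrite cesaro_measureE// ger0_norm ?mulr_ge0 ?invr_ge0 ?(ltW x0) ?fine_ge0//.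
rewrite ger0_norm ?cesaro_majorant_ge0// /log_step.
set k := log_index x; have /eqP : log_index x = k by [].
rewrite log_index_bounds// => /andP[kx xk].
(* The last summand alone suffices, as 1/x < e^(k+1) and [0, x] lies in [0, e^-k]; the others serve
   to make the majorant monotone in [k]. *)
rewrite /cesaro_majorant big_ord_recr/= ler_wpDl//.
  by apply: sumr_ge0 => j _; rewrite mulr_ge0 ?expR_ge0 ?fine_ge0.
apply: ler_pM; rewrite ?invr_ge0 ?(ltW x0) ?fine_ge0//.
  by rewrite -[leRHS]invrK -expRN lef_pV2 ?posrE ?expR_gt0// ltW.
apply: fine_le; rewrite ?leb_capI_fin//.
apply: le_measure; rewrite ?inE.
- by apply: measurableI => //; exact: measurable_leb_itv.
- by apply: measurableI => //; exact: measurable_leb_itv.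
- by apply: setIS; apply: subset_itvl; rewrite bnd_simp.
Qed.

(** By disjointness, each of the k+1 levels contributes at most e^(j+1) e^-j = e. *)
Lemma cesaro_majorant_sum (R : realType) n (P : 'I_n -> set (lebR R)) k :
  (forall i, measurable (P i)) -> trivIset setT P ->
  \sum_(i < n) cesaro_majorant (P i) k <= expR 1 * k.+1%:R.
Proof.
move=> mP tP; rewrite /cesaro_majorant exchange_big/=.
rewrite (_ : _ * _ = \sum_(j < k.+1) expR 1); last first.
  by rewrite sumr_const card_ord mulr_natr.
apply: ler_sum => j _; rewrite -mulr_sumr.
set I := `[0, expR (- j%:R)]%classic.
have mI : measurable (I : set (lebR R)) by exact: measurable_leb_itv.
have le1 : (leb R (\big[setU/set0]_(i < n) (P i `&` I)) <=
    (expR (- j%:R))%:E)%E.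
  rewrite -(leb_itv0 (expR_ge0 _)); apply: le_measure; rewrite ?inE//.
    by apply: bigsetU_measurable => i _; exact: measurableI.
  by elim/big_ind : _ => // A B AI BI t [/AI|/BI].
have -> : expR 1 = expR j.+1%:R * expR (- j%:R) :> R.
  by rewrite -expRD -natr1 addrAC subrr add0r.
rewrite ler_wpM2l ?expR_ge0//.
rewrite -lee_fin (le_trans _ le1)// measure_bigsetU_ord//=; last 2 first.
- by move=> i; exact: measurableI.
- exact: trivIset_setIr.
rewrite -sumEFin; apply: lee_sum => i _.
by rewrite fineK ?leb_capI_fin.
Qed.

(** * Domination in function spaces; nonnegative series *)

Lemma ae_eq01_trans (R : realType) (f g h : R -> R) :
  ae_eq01 f g -> ae_eq01 g h -> ae_eq01 f h.
Proof. exact: ae_eq_trans. Qed.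

Lemma bfs_fun0 (R : realType) (X : bfs R) : ae_eq01 (bfs_fun (0 : X)) (cst 0).
Proof.
have := @bfs_linear _ X 1 0 0; rewrite scale1r addr0.
apply: filterS => t /= h /h/eqP; rewrite mul1r => /eqP
  /(congr1 (fun z => z - bfs_fun (0 : X) t)).
by rewrite subrr addrK => <-.
Qed.

Lemma bfs_funZ (R : realType) (X : bfs R) (a : R) (x : X) :
  ae_eq01 (bfs_fun (a *: x)) (fun t => a * bfs_fun x t).
Proof.
have := @bfs_linear _ X a x 0; rewrite addr0.
apply: filterS2 (bfs_fun0 X) => t /= h0 h tI.
by rewrite h// h0//= addr0.
Qed.

Lemma bfs_norm_le (R : realType) (X : bfs R) (f : R -> R) (x : X) :
  ae_eq01 (bfs_fun x) f -> (bfs_norm X f <= `|x|%:E)%E.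
Proof. by move=> xf; apply: ereal_inf_lbound; exists x. Qed.

Lemma bfs_dominated (R : realType) (X : bfs R) (f g : R -> R) (x : X) :
  mfun01 g -> ae_eq01 (bfs_fun x) f ->
  (forall t, t \in `[0, 1] -> `|g t| <= `|f t|) ->
  exists2 y : X, ae_eq01 (bfs_fun y) g & `|y| <= `|x|.
Proof.
move=> mg xf gf; apply: bfs_ideal => //.
apply: filterS xf => t /= xft tI; rewrite xft//; apply: gf.
by [].
Qed.

Lemma nneseries_le_ub (R : realType) (f : nat -> \bar R) (M : \bar R) :
  (forall n, 0 <= f n)%E -> (forall n, \sum_(0 <= i < n) f i <= M)%E ->
  (\sum_(n <oo) f n <= M)%E.
Proof.
move=> f0 fM; apply: lime_le; first exact: is_cvg_nneseries.
by apply: nearW => n; exact: fM.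
Qed.

Lemma nneseries_ge_term (R : realType) (f : nat -> \bar R) (n : nat) :
  (forall n, 0 <= f n)%E -> (f n <= \sum_(n <oo) f n)%E.
Proof.
move=> f0; apply: (@le_trans _ _ (\sum_(0 <= i < n.+1) f i)%E).
  by rewrite big_nat_recr//= leeDr// sume_ge0.
exact: nneseries_lim_ge.
Qed.

Lemma nneseries_geometric_lty (R : realType) (q : R) :
  0 <= q < 1 -> (\sum_(n <oo) (q ^+ n)%:E < +oo)%E.
Proof.
move=> /andP[q0 q1].
apply: (@le_lt_trans _ _ ((1 - q)^-1)%:E); last exact: ltry.
apply: nneseries_le_ub => [n|n]; first by rewrite lee_fin exprn_ge0.
rewrite sumEFin lee_fin big_mkord -[leRHS]mul1r ler_pdivlMr ?subr_gt0//.
by rewrite mulrC -opprB mulNr -subrX1 opprB gerBl exprn_ge0.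
Qed.

Lemma nneseries_lty_le (R : realType) (f g : nat -> \bar R) :
  (forall n, 0 <= f n)%E -> (forall n, f n <= g n)%E ->
  (\sum_(n <oo) g n < +oo)%E -> (\sum_(n <oo) f n < +oo)%E.
Proof. by move=> f0 fg; apply: le_lt_trans; apply: lee_nneseries => // n _. Qed.

(** * From weighted sums to finite variation *)

Section weighted_sequences.
Context (R : realType) (X : bfs R) (w : nat -> R) (idx : nat -> nat).
Hypothesis w_ge0 : forall n, 0 <= w n.
Hypothesis w_cofinal : forall k, exists2 n, (k <= idx n)%N & 0 < w n.

Let wsum (H : nat -> R) : \bar R := (\sum_(n <oo) (w n * H (idx n))%:E)%E.

Hypothesis wsum_bfs : forall H, (forall k, 0 <= H k) -> nondecreasing_seq H ->
  (wsum H < +oo)%E -> bfs_set X (log_step H).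

Let wsum_ge0 H : (forall k, 0 <= H k) -> (0 <= wsum H)%E.
Proof.
by move=> H0; apply: nneseries_ge0 => n _ _; rewrite lee_fin mulr_ge0.
Qed.

(** Gliding hump: if no constant works, there are step functions whose rescalings have norm 2^n but
    weighted sum at most 2^-n. Their sum [G] has a finite weighted sum, hence lies in X, yet it
    dominates every one of them, so its norm exceeds every 2^n. *)
Lemma wsum_bound : exists2 K : R, 0 <= K &
  forall H, (forall k, 0 <= H k) -> nondecreasing_seq H -> (wsum H < +oo)%E ->
  exists2 x : X, ae_eq01 (bfs_fun x) (log_step H) &
    (`|x|%:E <= K%:E * wsum H)%E.
Proof.
apply: contrapT => noK.
have bad (n : nat) : exists Hx : (nat -> R) * X,
    [/\ forall k, 0 <= Hx.1 k, nondecreasing_seq Hx.1, (wsum Hx.1 < +oo)%E,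
     ae_eq01 (bfs_fun Hx.2) (log_step Hx.1) &
     ((4 ^+ n)%:E * wsum Hx.1 < `|Hx.2|%:E)%E].
  apply: contrapT => none; apply: noK; exists (4 ^+ n); first exact: exprn_ge0.
  move=> H H0 Hnd Hfin; have [_ [x xH]] := wsum_bfs H0 Hnd Hfin.
  exists x => //; rewrite leNgt; apply/negP => lt.
  by apply: none; exists (H, x).
have [Hx /all_and5[H0 Hnd Hfin xH big]] := choice bad.
pose H n := (Hx n).1; pose x n := (Hx n).2.
have x_gt0 n : 0 < `|x n|.
  rewrite -lte_fin; apply: le_lt_trans (big n); apply: mule_ge0.
    by rewrite lee_fin exprn_ge0.
  by apply: wsum_ge0; exact: H0.
(* Of the factor 4^n, one 2^n becomes the norm of [a n *: x n] and the other makes the weighted sum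
   small. *)
pose a n := 2 ^+ n / `|x n|.
have a_gt0 n : 0 < a n by rewrite divr_gt0 ?exprn_gt0.
have small n : ((a n)%:E * wsum (H n) <= (2^-1 ^+ n)%:E)%E.
  have wf : wsum (H n) \is a fin_num.
    by rewrite ge0_fin_numE; [exact: Hfin|apply: wsum_ge0; exact: H0].
  have := big n.
  rewrite -/(H n) -/(x n) -(fineK wf) -!EFinM lte_fin lee_fin => lt.
  rewrite /a mulrAC ler_pdivrMr// exprVn -(@ler_pM2l _ (2 ^+ n)) ?exprn_gt0//.
  rewrite mulrA -exprMn -natrM mulrA divff ?gt_eqF ?exprn_gt0// mul1r.
  exact: ltW.
have aH_ge0 n k : 0 <= a n * H n k.
  by rewrite mulr_ge0 ?(ltW (a_gt0 n))//; exact: H0.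
have term n m : w m * (a n * H n (idx m)) <= 2^-1 ^+ n.
  rewrite -lee_fin (le_trans _ (small n))// mulrCA EFinM lee_pmul2l ?lte_fin//.
  by apply: (nneseries_ge_term (f := fun m => (w m * H n (idx m))%:E)) => i;
    rewrite lee_fin mulr_ge0//; exact: H0.
(* By monotonicity the value at [k] is at most the value at some [idx m >= k] of positive weight,
   where [term] gives a geometric bound. *)
have Gfin k : (\sum_(n <oo) (a n * H n k)%:E \is a fin_num)%E.
  rewrite ge0_fin_numE; last by apply: nneseries_ge0 => n _ _; rewrite lee_fin.
  have [m km wm] := w_cofinal k.
  apply: (@nneseries_lty_le _ _
      (fun n => ((w m)^-1)%:E * (2^-1 ^+ n)%:E)%E) => [n|n|].
  - by rewrite lee_fin.
  - rewrite -EFinM lee_fin ler_pdivlMl// (le_trans _ (term n m))//.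
    by rewrite ler_pM2l// ler_pM2l//; exact: Hnd.
  - rewrite nneseriesZl; last by move=> n _; rewrite lee_fin exprn_ge0.
    rewrite lte_mul_pinfty ?lee_fin ?invr_ge0//.
    by apply: nneseries_geometric_lty; rewrite invr_ge0 ler0n/= invf_lt1
        ?ltr1n.
pose G k := fine (\sum_(n <oo) (a n * H n k)%:E).
have GE k : (G k)%:E = (\sum_(n <oo) (a n * H n k)%:E)%E by rewrite fineK.
have leG n k : a n * H n k <= G k.
  rewrite -lee_fin GE.
  by apply: (nneseries_ge_term (f := fun n => (a n * H n k)%:E)) => i;
    rewrite lee_fin.
have G0 k : 0 <= G k by rewrite (le_trans (aH_ge0 0 k)).
have Gnd : nondecreasing_seq G.
  move=> j k jk; rewrite -lee_fin !GE; apply: lee_nneseries => n _ => [_|].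
    by rewrite lee_fin.
  by rewrite lee_fin ler_pM2l//; exact: Hnd.
(* Interchanging the two sums turns the weighted sum of [G] into the sum of the rescaled weighted
   sums, bounded by that of 2^-n. *)
have Gsum : (wsum G < +oo)%E.
  rewrite /wsum (eq_eseriesr (g := fun m =>
      \sum_(n <oo) ((a n)%:E * (w m * H n (idx m))%:E))%E).
    rewrite nneseries_interchange; last first.
      move=> m n; rewrite -EFinM lee_fin mulrCA mulr_ge0//.
    apply: (@nneseries_lty_le _ _ (fun n => (2^-1 ^+ n)%:E)) => [n|n|].
    - apply: nneseries_ge0 => m _ _; rewrite -EFinM lee_fin mulrCA mulr_ge0//.
    - rewrite nneseriesZl; first exact: small.
      by move=> m _; rewrite lee_fin mulr_ge0//; exact: H0.
    - by apply: nneseries_geometric_lty; rewrite invr_ge0 ler0n/= invf_lt1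
        ?ltr1n.
  move=> m _; rewrite EFinM GE -nneseriesZl; last first.
    by move=> n _; rewrite lee_fin.
  by apply: eq_eseriesr => n _; rewrite -!EFinM mulrCA.
have [_ [y yG]] := wsum_bfs G0 Gnd Gsum.
have ley n : 2 ^+ n <= `|y|.
  have Zy : ae_eq01 (bfs_fun ((a n)^-1 *: y))
      (fun t => (a n)^-1 * log_step G t).
    apply: ae_eq01_trans (bfs_funZ _ _) _.
    by apply: filterS yG => t /= h tI; rewrite h.
  have [|t tI|z zH zy] := @bfs_dominated _ _ _ (log_step (H n)) _ _ Zy.
  - by apply: mfun01_log_step; exact: Hnd.
  - rewrite normrM (ger0_norm (x := (a n)^-1)) ?invr_ge0 ?(ltW (a_gt0 n))//.
    rewrite /log_step !ger0_norm//; last exact: H0.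
    by rewrite ler_pdivlMl// leG.
  (* The ideal property only provides some element representing [log_step (H n)]; injectivity
     identifies it with [x n]. *)
  have xz : x n = z.
    apply: bfs_inj; apply: ae_eq01_trans (xH n) _.
    by apply: filterS zH => t /= h tI; rewrite h.
  move: zy; rewrite -xz normrZ ger0_norm ?invr_ge0 ?(ltW (a_gt0 n))//.
  rewrite ler_pdivlMl// /a mulrVK ?unitfE ?gt_eqF//.
have := ley (Num.bound `|y|); rewrite leNgt => /negP; apply.
apply: lt_le_trans (archi_boundP (normr_ge0 y)) _.
by rewrite -natrX ler_nat ltnW// ltn_expl.
Qed.

(** The norm of each C(1_(P i)) is at most [K] times the weighted sum of its majorant. These sums
    add up to at most e times the series assumed finite, uniformly over partitions. *)
Lemma finite_variation_of_wsum :
  (\sum_(n <oo) (w n * (idx n).+1%:R)%:E < +oo)%E ->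
  finite_variation X (@cesaro_measure R).
Proof.
move=> fin.
have [K K0 HK] := wsum_bound.
set S := (\sum_(n <oo) _)%E in fin.
have S0 : (0 <= S)%E.
  by apply: nneseries_ge0 => n _ _; rewrite lee_fin mulr_ge0.
have Sfin : S \is a fin_num by rewrite ge0_fin_numE.
apply: (@le_lt_trans _ _ (K%:E * ((expR 1)%:E * S))%E); last first.
  by rewrite -(fineK Sfin) -!EFinM ltry.
apply: ge_ereal_sup => _ [n [P [[mP tP PI] ->]]].
have sum_maj : (\sum_(i < n) wsum (cesaro_majorant (P i)) <= (expR 1)%:E * S)%E.
  rewrite -nneseries_sum; last first.
    by move=> i j _; rewrite lee_fin mulr_ge0// cesaro_majorant_ge0.
  rewrite -nneseriesZl; last by move=> m _; rewrite lee_fin mulr_ge0.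
  apply: lee_nneseries => [m _ _|m _].
    by apply: sume_ge0 => i _; rewrite lee_fin mulr_ge0// cesaro_majorant_ge0.
  rewrite sumEFin -EFinM lee_fin -mulr_sumr mulrCA ler_wpM2l//.
  exact: cesaro_majorant_sum.
apply: (@le_trans _ _ (\sum_(i < n) K%:E * wsum (cesaro_majorant (P i)))%E).
  apply: lee_sum => i _.
  have ndP := @cesaro_majorant_nd _ (P i).
  have P0 := @cesaro_majorant_ge0 _ (P i).
  have finP : (wsum (cesaro_majorant (P i)) < +oo)%E.
    apply: (@le_lt_trans _ _ ((expR 1)%:E * S)%E); last first.
      by rewrite -(fineK Sfin) -!EFinM ltry.
    apply: le_trans sum_maj.
    rewrite (bigD1 i)//= leeDl// sume_ge0// => j _; apply: wsum_ge0.
    exact: cesaro_majorant_ge0.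
  have [x xP xK] := HK _ P0 ndP finP.
  have [|t tI|y yP yx] := bfs_dominated _ xP (g := cesaro_measure (P i)).
  - exact: mfun01_cesaro_measure.
  - exact: cesaro_measure_le_majorant.
  by rewrite (le_trans (bfs_norm_le yP))// (le_trans _ xK)// lee_fin.
rewrite -ge0_sume_distrr; last first.
  by move=> i _; apply: wsum_ge0; exact: cesaro_majorant_ge0.
by rewrite lee_wpmul2l// lee_fin.
Qed.

End weighted_sequences.

(** * Comparison of integrals with sums over steps *)

Section integral_of_steps.
Context d (T : measurableType d) (R : realType).
Context (mu : {measure set T -> \bar R}) (D : set T) (mD : measurable D).
Local Open Scope ereal_scope.

(* Unlike [ge0_le_integral], no measurability: the integral of a nonnegative
   function is a lower integral, which is monotone for arbitrary functions. *)
Lemma ge0_le_lower_integral (f g : T -> \bar R) :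
  (forall t, D t -> 0 <= f t) -> (forall t, D t -> f t <= g t) ->
  \int[mu]_(t in D) f t <= \int[mu]_(t in D) g t.
Proof.
move=> f0 fg.
rewrite !ge0_integralE//; last first.
  by move=> t Dt; exact: le_trans (f0 _ Dt) (fg _ Dt).
apply: ereal_sup_le => _ [h /= hf <-]; exists h => //= t.
apply: le_trans (hf t) _; rewrite /patch; case: ifPn => // /[!inE] Dt.
exact: fg.
Qed.

Context (c : nat -> \bar R) (A : nat -> set T).
Hypothesis c_ge0 : forall n, 0 <= c n.
Hypothesis mA : forall n, measurable (A n).

Let step_ge0 n t : 0 <= c n * (\1_(A n) t)%:E.
Proof. by rewrite mule_ge0// lee_fin. Qed.

Let measurable_step n : measurable_fun D (fun t => c n * (\1_(A n) t)%:E).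
Proof. by apply: measurable_funeM; apply/measurable_EFinP. Qed.

Lemma integral_steps :
  \int[mu]_(t in D) (\sum_(n <oo) c n * (\1_(A n) t)%:E) =
  \sum_(n <oo) c n * mu (A n `&` D).
Proof.
rewrite integral_nneseries//; apply: eq_eseriesr => n _.
rewrite ge0_integralZl//; last exact/measurable_EFinP.
by rewrite integral_indic.
Qed.

Lemma integral_le_steps (f : T -> \bar R) (N : set T) :
  measurable N -> mu N = 0 -> (forall t, D t -> 0 <= f t) ->
  (forall t, D t -> ~ N t -> exists2 n, A n t & f t <= c n) ->
  \int[mu]_(t in D) f t <= \sum_(n <oo) c n * mu (A n `&` D).
Proof.
move=> mN N0 f0 fc.
(* The majorant is made infinite on the null set [N], where [f] is uncontrolled; this adds nothing
   to its integral. *)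
apply: (@le_trans _ _ (\int[mu]_(t in D)
    (+oo * (\1_N t)%:E + \sum_(n <oo) c n * (\1_(A n) t)%:E))).
  apply: ge0_le_lower_integral => // t Dt.
  have [Nt|Nt] := pselect (N t).
    rewrite indicE mem_set// mule1 addye ?leey//.
    by rewrite gt_eqF// (lt_le_trans (ltNyr 0))// nneseries_ge0.
  have [n At fn] := fc t Dt Nt.
  rewrite indicE memNset// mule0 add0e (le_trans fn)//.
  apply: le_trans
    (nneseries_ge_term n (f := fun n => c n * (\1_(A n) t)%:E) _) => //.
  by rewrite indicE mem_set// mule1.
rewrite ge0_integralD//; first last.
- by apply: ge0_emeasurable_sum.
- by move=> t _; apply: nneseries_ge0 => n _ _.
- by apply: measurable_funeM; apply/measurable_EFinP.
rewrite integral_steps ge0_integralZl//; last exact/measurable_EFinP.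
rewrite integral_indic// (subset_measure0 (B := N))// ?mule0 ?add0e//.
exact: measurableI.
Qed.

Lemma steps_le_integral (f : T -> \bar R) :
  trivIset setT A -> (forall t, D t -> 0 <= f t) ->
  (forall n t, D t -> A n t -> c n <= f t) ->
  \sum_(n <oo) c n * mu (A n `&` D) <= \int[mu]_(t in D) f t.
Proof.
move=> tA f0 cf; rewrite -integral_steps.
apply: ge0_le_lower_integral => t Dt; first exact: nneseries_ge0.
(* By disjointness at most one term of the series is nonzero at [t]. *)
have [[k Akt]|noA] := pselect (exists k, A k t); last first.
  rewrite eseries0 ?f0// => n _ _.
  by rewrite indicE memNset ?mule0// => Ant; apply: noA; exists n.
rewrite (nneseriesD1 (n := k))//= eseries0 => [|n _ nk].
  by rewrite adde0 indicE mem_set// mule1 cf.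
rewrite indicE memNset ?mule0// => Ant.
by move/eqP: nk; apply; apply: (tA n k) => //; exists t.
Qed.

End integral_of_steps.

(** * The exponential class *)

Definition log_block (R : realType) (k : nat) : set R :=
  `]expR (- k.+1%:R), expR (- k%:R)]%classic.
Arguments log_block R k : clear implicits.

Lemma log_blockP (R : realType) (t : R) (k : nat) :
  log_block R k t <-> [/\ 0 < t, t <= 1 & log_index t = k].
Proof.
rewrite /log_block /= in_itv/=; split => [/andP[kt tk]|[t0 t1 /eqP]].
  have t0 : 0 < t by exact: lt_trans (expR_gt0 _) kt.
  have t1 : t <= 1 by rewrite (le_trans tk)// -expR0 ler_expR oppr_le0.
  by split => //; apply/eqP; rewrite log_index_bounds// kt.
by rewrite log_index_bounds.
Qed.

Lemma leb_log_block_le (R : realType) (k : nat) :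
  (leb R (log_block R k) <= (expR (- k%:R))%:E)%E.
Proof.
rewrite leb_lebesgue lebesgue_measure_itv/=; case: ifP => _.
  by rewrite -EFinD lee_fin gerBl expR_ge0.
by rewrite lee_fin expR_ge0.
Qed.

Lemma leb_set0 (R : realType) : leb R [set 0] = 0%E.
Proof. exact: lebesgue_measure_set1. Qed.

(** With the constant 1/(2D), the integrand is at most e^((k+1)/2) on the k-th block, of measure at
    most e^-k: the integral is bounded by a geometric series of ratio e^(-1/2). *)
Lemma Lexp_log_step (R : realType) (p D : R) (H : nat -> R) :
  0 < D -> (forall k, 0 <= H k) -> nondecreasing_seq H ->
  (forall k, H k `^ p <= D * k.+1%:R) -> Lexp R p (log_step H).
Proof.
move=> D0 H0 Hnd HD; split; first exact: mfun01_log_step.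
exists (2 * D)^-1; first by rewrite invr_gt0 mulr_gt0.
pose c k : \bar R := (expR (2^-1 * k.+1%:R))%:E.
have c0 k : (0 <= c k)%E by rewrite lee_fin expR_ge0.
have mB k : measurable (log_block R k : set (lebR R)).
  exact: measurable_leb_itv.
apply: (@le_lt_trans _ _
    (\sum_(k <oo) c k * leb R (log_block R k `&` I01 R))%E).
  apply: (@integral_le_steps _ _ _ (leb R) _ _ c (log_block R)
      _ _ _ [set 0]) => //.
  - exact: measurable_leb_itv.
  - rewrite -[X in measurable X]set_itv1; exact: measurable_leb_itv.
  - exact: leb_set0.
  move=> t; rewrite /I01/= in_itv/= => /andP[].
  rewrite le_eqVlt => /predU1P[<-//|t0] t1 _.
  exists (log_index t); first exact/log_blockP.
  rewrite lee_fin ler_expR ger0_norm; last exact: H0.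
  rewrite invfM -mulrA ler_pM2l ?invr_gt0// ler_pdivrMl//; exact: HD.
apply: (@nneseries_lty_le _ _
    (fun k => (expR 2^-1)%:E * (expR (- 2^-1) ^+ k)%:E)%E) => [k|k|].
- by rewrite mule_ge0.
- apply: (@le_trans _ _ (c k * (expR (- k%:R))%:E)%E).
    rewrite lee_wpmul2l// (le_trans _ (leb_log_block_le R k))//.
    apply: le_measure; rewrite ?inE//.
    by apply: measurableI => //; exact: measurable_leb_itv.
  rewrite -!EFinM lee_fin -expRM_natl -!expRD ler_expR -natr1 le_eqVlt.
  by apply/orP; left; apply/eqP; field.
rewrite nneseriesZl => [|k _]; last by rewrite lee_fin exprn_ge0 ?expR_ge0.
rewrite lte_mul_pinfty ?lee_fin ?expR_ge0//; apply: nneseries_geometric_lty.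
by rewrite expR_ge0/= -expR0 ltr_expR oppr_lt0 invr_gt0.
Qed.

(** With weights 2^-n at indices about 2^(pn), a finite weighted sum forces H(k)^p to grow at most
    linearly, while the weighted sum of k+1 behaves like that of 2^((p-1)n), which converges as p <
    1. *)
Lemma finite_variation_Lexp (R : realType) (X : bfs R) (p : R) :
  0 < p < 1 -> Lexp R p `<=` bfs_set X ->
  finite_variation X (@cesaro_measure R).
Proof.
move=> /andP[p0 p1] LX.
pose b : R := 2 `^ p; pose idx n := Num.truncn (b ^+ n).
have b_gt0 : 0 < b by rewrite powR_gt0.
have b_ge1 : 1 <= b by rewrite -(powRr0 2) ler_powR ?ler1n// ltW.
have b_lt2 : b < 2.
  rewrite /b /powR ifF ?pnatr_eq0// -[ltRHS]lnK ?posrE// ltr_expR gtr_pMl//.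
  by rewrite ln_gt0// ltr1n.
have idx_le n : (idx n)%:R <= b ^+ n.
  by rewrite truncn_le ?exprn_ge0// ltW.
have lt_idx n : b ^+ n < (idx n).+1%:R by exact: truncnS_gt.
have idx_cofinal k : exists n, (k <= idx n)%N.
  (* Chosen so that b^n = e^(n p ln 2) >= 1 + n p ln 2 >= k. *)
  pose n := Num.bound (k%:R / (p * ln 2)).
  have ln2 : 0 < p * ln 2 :> R by rewrite mulr_gt0// ln_gt0// ltr1n.
  exists n; rewrite truncn_ge_nat; last by rewrite exprn_ge0// ltW.
  have kn : k%:R <= n%:R * (p * ln 2) :> R.
    by rewrite -ler_pdivrMr// ltW// archi_boundP// divr_ge0// ltW.
  rewrite /b /powR ifF ?pnatr_eq0// -expRM_natl.
  by rewrite (le_trans kn)// (le_trans _ (expR_ge1Dx _))// lerDr ler01.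
apply: (@finite_variation_of_wsum _ X (fun n => 2^-1 ^+ n) idx).
- by move=> n; rewrite exprn_ge0.
- by move=> k; have [n kn] := idx_cofinal k; exists n => //; rewrite exprn_gt0.
- move=> H H0 Hnd Hfin; apply: LX.
  set W := (\sum_(n <oo) _)%E in Hfin.
  have W0 : (0 <= W)%E.
    by apply: nneseries_ge0 => n _ _; rewrite lee_fin mulr_ge0// exprn_ge0.
  pose C := fine W + 1.
  have C0 : 0 < C by rewrite ltr_wpDl ?fine_ge0.
  have HC n : H (idx n) <= C * 2 ^+ n.
    have : 2^-1 ^+ n * H (idx n) <= fine W.
      rewrite -lee_fin fineK ?ge0_fin_numE//.
      apply: (nneseries_ge_term n (f := fun n => (2^-1 ^+ n * H (idx n))%:E)).
      by move=> i; rewrite lee_fin mulr_ge0// exprn_ge0.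
    rewrite exprVn ler_pdivrMl ?exprn_gt0// => /le_trans; apply.
    by rewrite mulrC ler_pM2r ?exprn_gt0// lerDl.
  apply: (@Lexp_log_step _ _ ((2 * C) `^ p)) => // [|k].
    by apply: powR_gt0; rewrite mulr_gt0.
  (* Take the least index reaching [k]. If it is n+1, then H(k) <= 2 C 2^n, and [idx n < k] gives
     2^(pn) = b^n < k+1; if it is 0, H(k) <= C suffices. *)
  case: (ex_minnP (idx_cofinal k)) => -[|n] kn nmin.
    apply: (@le_trans _ _ ((2 * C) `^ p)); last first.
      by rewrite ler_peMr ?powR_ge0 ?ler1n.
    apply: ge0_ler_powR; rewrite ?nnegrE ?(ltW p0) ?mulr_ge0 ?(ltW C0)//.
    rewrite (le_trans (Hnd _ _ kn))// (le_trans (HC _))// expr0 mulr1.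
    by rewrite ler_peMl ?ler1n// ltW.
  have nk : (idx n < k)%N by rewrite ltnNge; apply/negP => /nmin; rewrite ltnn.
  apply: (@le_trans _ _ ((2 * C * 2 ^+ n) `^ p)).
    apply: ge0_ler_powR;
      rewrite ?nnegrE ?(ltW p0) ?mulr_ge0 ?exprn_ge0 ?(ltW C0)//.
    rewrite (le_trans (Hnd _ _ kn))// (le_trans (HC _))// exprS mulrA.
    by rewrite (mulrC C).
  rewrite powRM ?mulr_ge0 ?exprn_ge0 ?(ltW C0)// ler_pM2l ?powR_gt0 ?mulr_gt0//.
  rewrite -powR_mulrn// -powRrM mulrC powRrM powR_mulrn ?powR_ge0//.
  by rewrite (le_trans (ltW (lt_idx n)))// ler_nat ltnW.
- apply: (@nneseries_lty_le _ _
      (fun n => 2%:E * ((b / 2) ^+ n)%:E)%E) => [n|n|].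
  + by rewrite lee_fin mulr_ge0// exprn_ge0.
  + rewrite -EFinM lee_fin exprVn expr_div_n mulrA [leLHS]mulrC.
    rewrite ler_pM2r ?invr_gt0 ?exprn_gt0//.
    rewrite -natr1 mulr_natl mulr2n lerD//.
    by rewrite exprn_ege1.
  rewrite nneseriesZl => [|k _]; last first.
    by rewrite lee_fin exprn_ge0// divr_ge0 ?ltW.
  rewrite lte_mul_pinfty//; apply: nneseries_geometric_lty.
  by rewrite divr_ge0 ?(ltW b_gt0)//= ltr_pdivrMr// mul1r.
Qed.

(** * One-sided derivatives of a concave weight *)

Definition slope (R : realType) (f : R -> R) (s t : R) : R :=
  (f t - f s) / (t - s).

Section weight_slopes.
Context (R : realType) (phi : lorentz_weight R).

Lemma weight_three_points (s t u : R) : 0 <= s -> s < t -> t < u -> u <= 1 ->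
  (u - t) * phi s + (t - s) * phi u <= (u - s) * phi t.
Proof.
move=> s0 st tu u1; have su := lt_trans st tu.
have us0 : 0 < u - s by rewrite subr_gt0.
pose l := (u - t) / (u - s).
have l0 : 0 <= l by rewrite divr_ge0 ?subr_ge0// ltW.
have l1 : l <= 1 by rewrite ler_pdivrMr// mul1r lerD2l lerN2 ltW.
have : - phi (l * s + (1 - l) * u) <= l * - phi s + (1 - l) * - phi u.
  by apply: (@weight_concave _ phi (Itv01 l0 l1) s u);
    rewrite inE/= in_itv/= ?s0 ?u1 ?(ltW (lt_le_trans su u1))
      ?(le_trans s0 (ltW su)).
have -> : l * s + (1 - l) * u = t by rewrite /l; field; rewrite gt_eqF.
rewrite -(ler_pM2l us0).
have -> : (u - s) * (l * - phi s + (1 - l) * - phi u) =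
    - ((u - t) * phi s + (t - s) * phi u).
  by rewrite /l; field; rewrite gt_eqF.
by rewrite mulrN lerN2.
Qed.

Lemma slope_le_left (s t u : R) : 0 <= s -> s < t -> t < u -> u <= 1 ->
  slope phi s u <= slope phi s t.
Proof.
move=> s0 st tu u1; have := weight_three_points s0 st tu u1; rewrite /slope.
rewrite ler_pdivrMr ?subr_gt0 ?(lt_trans st)// mulrAC ler_pdivlMr ?subr_gt0//.
by move=> ?; lra.
Qed.

Lemma slope_le_right (s t u : R) : 0 <= s -> s < t -> t < u -> u <= 1 ->
  slope phi t u <= slope phi s u.
Proof.
move=> s0 st tu u1; have := weight_three_points s0 st tu u1; rewrite /slope.
rewrite ler_pdivrMr ?subr_gt0// mulrAC ler_pdivlMr ?subr_gt0 ?(lt_trans st)//.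
by move=> ?; lra.
Qed.

Lemma slope_le_adjacent (s t u : R) : 0 <= s -> s < t -> t < u -> u <= 1 ->
  slope phi t u <= slope phi s t.
Proof.
by move=> s0 st tu u1; apply: le_trans (slope_le_right s0 st tu u1) _;
  exact: slope_le_left.
Qed.

(** By concavity the slopes from [t] decrease in [u], so the supremum of this set is the right
    derivative at [t]; likewise the infimum of [left_slopes] is the left derivative. *)
Definition right_slopes (t : R) : set R :=
  [set slope phi t u | u in `]t, 1]%classic].

Definition left_slopes (t : R) : set R :=
  [set slope phi s t | s in `[0, t[%classic].

Lemma right_slopes_le_left (t r l : R) :
  right_slopes t r -> left_slopes t l -> r <= l.
Proof.
move=> [u /=]; rewrite in_itv/= => /andP[tu u1] <-.
move=> [s /=]; rewrite in_itv/= => /andP[s0 st] <-.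
exact: slope_le_adjacent.
Qed.

Lemma has_sup_right_slopes (t : R) : 0 < t -> t < 1 -> has_sup (right_slopes t).
Proof.
move=> t0 t1; split.
  by exists (slope phi t 1), 1 => //=; rewrite in_itv/= t1 lexx.
exists (slope phi 0 t) => r rt; apply: right_slopes_le_left rt _.
by exists 0 => //=; rewrite in_itv/= lexx.
Qed.

Lemma has_inf_left_slopes (t : R) : 0 < t -> t < 1 -> has_inf (left_slopes t).
Proof.
move=> t0 t1; split.
  by exists (slope phi 0 t), 0 => //=; rewrite in_itv/= lexx.
exists (slope phi t 1) => r rt; apply: right_slopes_le_left rt.
by exists 1 => //=; rewrite in_itv/= t1 lexx.
Qed.

(* The points where the left and right derivatives differ. *)
Definition corners : set R :=
  [set t | [/\ 0 < t, t < 1 & sup (right_slopes t) < inf (left_slopes t)]].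

Lemma countable_corners : countable corners.
Proof.
(* The gaps ]phi'_+(t), phi'_-(t)[ are disjoint: pick a rational in each. *)
have /choice[q qP] t : exists q : rat, corners t ->
    sup (right_slopes t) < ratr q < inf (left_slopes t).
  have [[t0 t1 /rat_in_itvoo[q]]|nt] := pselect (corners t); last first.
    by exists 0 => /nt.
  by rewrite in_itv/= => qt; exists q.
have q_lt s t : s < t -> corners s -> corners t -> q t < q s.
  move=> st cs ct; rewrite -(ltr_rat R).
  have [s0 s1 _] := cs; have [t0 t1 _] := ct.
  have /andP[qs _] := qP _ cs; have /andP[_ qt] := qP _ ct.
  apply: lt_trans qt (le_lt_trans _ qs).
  (* The slope of the chord from [s] to [t] separates the two gaps. *)
  apply: (@le_trans _ _ (slope phi s t)).
    apply: ge_inf; first by case: (has_inf_left_slopes t0 t1).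
    by exists s => //=; rewrite in_itv/= (ltW s0).
  apply: ub_le_sup; first by case: (has_sup_right_slopes s0 s1).
  by exists t => //=; rewrite in_itv/= st ltW.
apply/countable_injP; exists (fun t => pickle (q t)) => s t.
rewrite !inE => cs ct /(pcan_inj pickleK) qst.
by case: (ltgtP s t) => // /q_lt; [move=> /(_ cs ct)|move=> /(_ ct cs)];
  rewrite qst ltxx.
Qed.

(** Off the corners the one-sided derivatives agree, so the derivative exists and equals the right
    one, which by concavity is at least the slope of any chord further right. *)
Lemma derive1_weight_ge (t a b : R) : 0 < t -> t <= a -> a < b -> b <= 1 ->
  ~ corners t -> slope phi a b <= derive1 phi t.
Proof.
move=> t0 ta ab b1 nct.
have tb := le_lt_trans ta ab; have t1 := lt_le_trans tb b1.
have supS := has_sup_right_slopes t0 t1; have infS := has_inf_left_slopes t0 t1.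
pose d := sup (right_slopes t).
have le_d u : t < u -> u <= 1 -> slope phi t u <= d.
  move=> tu u1; apply: ub_le_sup; first by case: supS.
  by exists u => //=; rewrite in_itv/= tu.
have d_le s : 0 <= s -> s < t -> d <= slope phi s t.
  move=> s0 st; apply: ge_sup; first by case: supS.
  move=> r rt; apply: right_slopes_le_left rt _.
  by exists s => //=; rewrite in_itv/= s0.
have infd : inf (left_slopes t) <= d.
  by rewrite leNgt; apply/negP => lt; apply: nct.
have cvgd : h^-1 *: (phi (h + t) - phi t) @[h --> 0^'] --> d.
  apply/cvgrPdist_le => e e0.
  (* Slopes to [u] and from [s] are within [e] of [d]; monotonicity of slopes traps every difference
     quotient with smaller increment. *)
  have [_ [u uI <-] du] := sup_adherent e0 supS.
  have [_ [s sI <-] ds] := inf_adherent e0 infS.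
  move: uI sI; rewrite /= !in_itv/= => /andP[tu u1] /andP[s0 st].
  near=> h.
  have h0 : h != 0 by near: h; exact: nbhs_dnbhs_neq.
  have hu : h < u - t.
    near: h; apply: nbhs_dnbhs; apply: lt_nbhsl; by rewrite subr_gt0.
  have hs : s - t < h.
    near: h; apply: nbhs_dnbhs; apply: lt_nbhsr; by rewrite subr_lt0.
  have [hN|hP|/eqP] := ltgtP h 0; last by rewrite (negbTE h0).
  - have -> : h^-1 *: (phi (h + t) - phi t) = slope phi (h + t) t.
      have e1 : t - (h + t) = - h by ring.
      by rewrite /slope /GRing.scale/= e1 invrN mulrN -mulNr opprB mulrC.
    have sh : s < h + t by rewrite -ltrBlDr.
    have ht : h + t < t by rewrite gtrDr.
    have h1 := slope_le_right s0 sh ht (ltW t1).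
    have h2 := d_le _ (le_trans s0 (ltW sh)) ht.
    rewrite ler_norml; apply/andP; split; rewrite -/d in infd ds du *; lra.
  - have -> : h^-1 *: (phi (h + t) - phi t) = slope phi t (h + t).
      by rewrite /slope /GRing.scale/= mulrC addrK.
    have hu' : h + t < u by rewrite -ltrBrDr.
    have th : t < h + t by rewrite ltrDr.
    have h1 := slope_le_left (ltW t0) th hu' u1.
    have h2 := le_d _ th (le_trans (ltW hu') u1).
    rewrite ler_norml; apply/andP; split; rewrite -/d in du *; lra.
have -> : derive1 phi t = d by exact: cvg_lim cvgd.
apply: le_trans (le_d _ tb b1).
move: ta; rewrite le_eqVlt => /predU1P[->//|ta].
by apply: slope_le_right => //; exact: ltW.
Unshelve. all: by end_near. Qed.

(* Where the difference quotient does not converge, [derive1] is [0]. *)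
Lemma derive1_weight_ge0 (t : R) : 0 < t -> t < 1 -> 0 <= derive1 phi t.
Proof.
move=> t0 t1; rewrite /derive1.
have [dv|ndv] := pselect (cvg (h^-1 *: (phi (h + t) - phi t) @[h --> 0^'])).
  apply: limr_ge => //; near=> h.
  have h1 : h < 1 - t.
    by near: h; apply: nbhs_dnbhs; apply: lt_nbhsl; rewrite subr_gt0.
  have h0 : - t < h.
    by near: h; apply: nbhs_dnbhs; apply: lt_nbhsr; rewrite oppr_lt0.
  have tI : t \in `[0, 1] by rewrite in_itv/= !ltW.
  have htI : h + t \in `[0, 1].
    by rewrite in_itv/= -lerBlDr sub0r (ltW h0) -lerBrDr (ltW h1).
  have [hN|hP] := leP h 0.
    apply: mulr_le0; first by rewrite invr_le0.
    by rewrite subr_le0 weight_nd// gerDr.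
  apply: mulr_ge0; first by rewrite invr_ge0 ltW.
  by rewrite subr_ge0 weight_nd// lerDr ltW.
by rewrite (dvgP ndv).
Unshelve. all: by end_near. Qed.

End weight_slopes.

(** * The Lorentz space *)

Lemma rearrangement_ge0 (R : realType) (f : R -> R) (s : R) : (0 <= rearrangement f s)%E.
Proof. by apply: le_ereal_inf_tmp => _ [tau [tau0 _] <-]; rewrite lee_fin. Qed.

(** The step function is nonincreasing on ]0, 1], so it exceeds its value at [s] only inside [0, s];
    that value is thus an admissible level in the infimum. *)
Lemma rearrangement_log_step_le (R : realType) (H : nat -> R) (s : R) :
  (forall k, 0 <= H k) -> nondecreasing_seq H -> 0 < s -> s <= 1 ->
  (rearrangement (log_step H) s <= (log_step H s)%:E)%E.
Proof.
move=> H0 Hnd s0 s1; apply: ereal_inf_lbound; exists (log_step H s) => //.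
split; first exact: H0.
rewrite -(leb_itv0 (ltW s0)); apply: le_measure; rewrite ?inE.
- have -> : [set t | I01 R t /\ log_step H s < `|log_step H t| ] =
      I01 R `&` log_step H @^-1` `]log_step H s, +oo[%classic.
    apply/seteqP; split=> t /= [tI lt]; split => //; move: lt;
      by rewrite in_itv/= andbT ger0_norm//; exact: H0.
  apply: (mfun01_log_step Hnd); first exact: measurable_leb_itv.
  exact: measurable_itv.
- exact: measurable_leb_itv.
move=> t /= []; rewrite /I01/= !in_itv/= => /andP[t0 t1].
rewrite ger0_norm; last exact: H0.
rewrite t0/= leNgt; apply: contraTN => st; rewrite -leNgt.
apply: Hnd; apply: le_truncn; rewrite lerN2 ler_ln ?posrE ?(ltW st)//.
exact: lt_trans st.
Qed.

Section lorentz_weights.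
Context (R : realType) (phi : lorentz_weight R).
Local Notation mu := (lebesgue_stieltjes_measure (weight_ext phi)).

Definition weight_increment (n : nat) : R :=
  phi (expR (- n%:R)) - phi (expR (- n.+1%:R)).

Let expRN_itv n : expR (- n%:R) \in `[0 : R, 1].
Proof. by rewrite in_itv/= expR_ge0 -expR0 ler_expR oppr_le0/=. Qed.

Let expRN_lt n : expR (- n.+1%:R) < expR (- n%:R) :> R.
Proof. by rewrite ltr_expR ltrN2 ltr_nat. Qed.

Lemma weight_increment_ge0 n : 0 <= weight_increment n.
Proof. by rewrite subr_ge0 weight_nd ?expRN_itv// ltW. Qed.

Let weight_ext_itv t : t \in `[0, 1] -> weight_ext phi t = phi t.
Proof. by move=> tI; rewrite /weight_ext clamp01_id. Qed.

Lemma stieltjes_itvoc (a b : R) : a <= b ->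
  mu `]a, b]%classic = (weight_ext phi b - weight_ext phi a)%:E.
Proof.
move=> ab; rewrite /lebesgue_stieltjes_measure /measure_extension.
rewrite measurable_mu_extE/=; last by exists (a, b).
by rewrite wlength_itv_bnd.
Qed.

Lemma stieltjes_log_block n : mu (log_block R n) = (weight_increment n)%:E.
Proof.
by rewrite stieltjes_itvoc ?(ltW (expRN_lt n))// !weight_ext_itv// expRN_itv.
Qed.

(** The extended weight is constant on [-1, 0], so ]-1, 0] has no mass. *)
Lemma stieltjes_set0 : mu [set 0] = 0%E.
Proof.
apply/eqP; rewrite eq_le measure_ge0 andbT.
apply: (@le_trans _ _ (mu `]-1, 0]%classic)).
  apply: le_measure; rewrite ?inE//.
  by move=> _ ->; rewrite /= in_itv/= lexx oppr_lt0 ltr01.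
rewrite stieltjes_itvoc ?oppr_le0// /weight_ext !max_l ?oppr_le0//.
by rewrite subrr.
Qed.

Lemma lorentz_log_step (H : nat -> R) :
  (forall k, 0 <= H k) -> nondecreasing_seq H ->
  (\sum_(n <oo) (weight_increment n * H n)%:E < +oo)%E ->
  lorentz phi (log_step H).
Proof.
move=> H0 Hnd Hfin; split; first exact: mfun01_log_step.
apply: le_lt_trans Hfin.
apply: (@le_trans _ _
    (\sum_(n <oo) (H n)%:E * mu (log_block R n `&` `[0%R, 1%R]%classic))%E).
  (* The point 0, where the rearrangement is the essential supremum and may be infinite, is the null
     set to discard. *)
  apply: (@integral_le_steps _ _ _ mu _ _ (fun n => (H n)%:E) (log_block R)
      _ _ _ [set 0]) => //.
  - by move=> n; exact: measurable_itv.
  - exact: stieltjes_set0.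
  - by move=> t _; exact: rearrangement_ge0.
  move=> t /=; rewrite in_itv/= => /andP[].
  rewrite le_eqVlt => /predU1P[<-//|t0] t1 _.
  exists (log_index t); first exact/log_blockP.
  exact: rearrangement_log_step_le.
apply: lee_nneseries => [n _|n _]; first by rewrite mule_ge0// lee_fin.
rewrite mulrC EFinM -stieltjes_log_block lee_wpmul2l ?lee_fin//.
apply: le_measure; rewrite ?inE//; last exact: measurable_itv.
by apply: measurableI; exact: measurable_itv.
Qed.

(** By concavity a nonzero weight is positive at e^-k. If all increments from [k] on vanished, this
    value would persist along e^-n, against the limit 0 at the origin. *)
Lemma weight_increment_cofinal (k : nat) :
  exists2 n, (k <= n)%N & 0 < weight_increment n.
Proof.
have phi_gt0 : 0 < phi (expR (- k%:R)).
  have [t tI tneq0] := weight_neq0 phi.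
  move: (tI); rewrite in_itv/= => /andP[t0 t1].
  have t_gt0 : 0 < t.
    rewrite lt_neqAle t0 andbT; apply: contraNN tneq0 => /eqP <-.
    by rewrite weight0.
  have phit : 0 < phi t by rewrite lt_neqAle eq_sym tneq0 weight_ge0.
  have [le|lt] := leP t (expR (- k%:R)).
    by apply: lt_le_trans phit _; rewrite weight_nd ?expRN_itv.
  have := @weight_chord _ phi _ t (expR_gt0 _) (ltW lt) t1.
  by move=> /(lt_le_trans phit); rewrite pmulr_rgt0// divr_gt0// expR_gt0.
apply: contrapT => none.
have const n : phi (expR (- k%:R)) <= phi (expR (- (n + k)%:R)).
  elim: n => [//|n IH]; apply: le_trans IH _.
  rewrite -subr_le0 leNgt; apply/negP => pos; apply: none.
  by exists (n + k)%N => //; exact: leq_addl.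
have : \forall x \near 0^'+, phi x < phi (expR (- k%:R)).
  exact: cvgr_lt (weight_cvg0 phi) _ phi_gt0.
move=> [e /= e0 near_lt].
pose n := Num.bound `|ln e|.
have : phi (expR (- (n + k)%:R)) < phi (expR (- k%:R)).
  apply: near_lt; last exact: expR_gt0.
  rewrite /= sub0r normrN ger0_norm ?expR_ge0// -[ltRHS]lnK ?posrE//.
  rewrite ltr_expR ltrNl.
  apply: (@lt_le_trans _ _ n%:R); last by rewrite ler_nat leq_addr.
  by rewrite (le_lt_trans (ler_norm _))// normrN archi_boundP.
by rewrite ltNge const.
Qed.

(** The n-th increment is compared with the integral over the next block, closer to 0. There
    log(1/t) >= n+1, and off the corners the derivative is at least the slope across block n; the
    lengths of the two blocks differ by the factor e. *)
Lemma weight_increment_log_lty :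
  (\int[leb R]_(t in `]0%R, 1%R[) (ln (1 / t) * derive1 phi t)%:E < +oo)%E ->
  (\sum_(n <oo) (weight_increment n * n.+1%:R)%:E < +oo)%E.
Proof.
move=> fin.
pose D : set (lebR R) := `]0%R, 1%R[%classic.
have mD : measurable D by exact: measurable_leb_itv.
have mC : measurable (corners phi : set (lebR R)).
  apply: measurable_leb; apply: countable_measurable => //.
  exact: countable_corners.
have leb_corners : leb R (corners phi) = 0%E.
  rewrite leb_lebesgue; apply: countable_lebesgue_measure0.
  exact: countable_corners.
(* Removing the corners, a null set, keeps the measure of the block and makes the bound on the
   derivative valid at every remaining point. *)
pose A n : set (lebR R) := log_block R n.+1 `\` corners phi.
have mB n : measurable (log_block R n : set (lebR R)).
  exact: measurable_leb_itv.
have mA n : measurable (A n) by exact: measurableD.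
pose sl n := slope phi (expR (- n.+1%:R)) (expR (- n%:R)).
have sl0 n : 0 <= sl n.
  by rewrite divr_ge0 ?weight_increment_ge0// subr_ge0 ltW.
pose c n : \bar R := (n.+1%:R * sl n)%:E.
have c0 n : (0 <= c n)%E by rewrite lee_fin mulr_ge0.
have D_block n t : log_block R n.+1 t -> D t.
  rewrite /log_block /D/= !in_itv/= => /andP[nt tn].
  by rewrite (lt_trans (expR_gt0 _) nt)/= (le_lt_trans tn).
apply: (@le_lt_trans _ _ ((expR 1)%:E *
    \int[leb R]_(t in D) (ln (1 / t) * derive1 phi t)%:E)%E); last first.
  by apply: lte_mul_pinfty => //; rewrite lee_fin expR_ge0.
apply: (@le_trans _ _ ((expR 1)%:E * \sum_(n <oo) c n * leb R (A n `&` D))%E).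
  rewrite -nneseriesZl; last by move=> n _; rewrite mule_ge0.
  apply: lee_nneseries => [n _|n _].
    by rewrite lee_fin mulr_ge0// weight_increment_ge0.
  have -> : A n `&` D = A n.
    by apply/setIidPl => t [/D_block].
  have lebA : ((expR (- n.+1%:R) - expR (- n.+2%:R))%:E <= leb R (A n))%E.
    rewrite (_ : _%:E = leb R (log_block R n.+1)); last first.
      by rewrite leb_lebesgue lebesgue_measure_itv/= lte_fin expRN_lt EFinB.
    rewrite -[leRHS]adde0 -leb_corners -measureU//; last first.
      by apply/seteqP; split => // t [[_ nt] /nt].
    apply: le_measure; rewrite ?inE//; first exact: measurableU.
    by move=> t Bt; have [?|?] := pselect (corners phi t); [right|left].
  apply: (@le_trans _ _ ((expR 1)%:E *
      (c n * (expR (- n.+1%:R) - expR (- n.+2%:R))%:E))%E); last first.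
    by rewrite !lee_wpmul2l// lee_fin expR_ge0.
  rewrite -!EFinM lee_fin /sl /slope -/(weight_increment n).
  (* The factor e turns the length of block n+1 into that of block n, which cancels the denominator
     of the slope. *)
  have e1 m : expR (- m%:R) = expR 1 * expR (- m.+1%:R) :> R.
    by rewrite -expRD -natr1 opprD addrCA subrr addr0.
  have := expRN_lt n; rewrite -subr_gt0 => lt.
  rewrite le_eqVlt; apply/orP; left; apply/eqP.
  rewrite mulrCA mulrBr -!e1.
  by field; rewrite gt_eqF.
rewrite lee_wpmul2l ?lee_fin ?expR_ge0//.
apply: steps_le_integral => //.
- apply/trivIsetP => i j _ _ ij; apply/seteqP; split => // t [[Bi _] [Bj _]].
  move/log_blockP : Bi => [_ _ ti]; move/log_blockP : Bj => [_ _ tj].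
  by move: ij; rewrite -(inj_eq succn_inj) -ti tj eqxx.
- move=> t; rewrite /D/= in_itv/= => /andP[t0 t1].
  rewrite lee_fin mulr_ge0 ?derive1_weight_ge0// ln_ge0//.
  by rewrite ler_pdivlMr// mul1r ltW.
- move=> n t; rewrite /D/= in_itv/= => /andP[t0 t1] [].
  rewrite /log_block/= in_itv/= => /andP[_ tn] nc.
  rewrite lee_fin; apply: ler_pM => //.
    by rewrite div1r lnV ?posrE// lerNr -[leRHS]expRK ler_ln ?posrE// expR_gt0.
  exact: derive1_weight_ge.
Qed.

End lorentz_weights.

Lemma finite_variation_lorentz (R : realType) (X : bfs R)
    (phi : lorentz_weight R) :
  lorentz phi `<=` bfs_set X ->
  (\int[leb R]_(t in `]0%R, 1%R[) (ln (1 / t) * derive1 phi t)%:E < +oo)%E ->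
  finite_variation X (@cesaro_measure R).
Proof.
move=> LX fin.
apply: (@finite_variation_of_wsum _ X (weight_increment phi) id).
- exact: weight_increment_ge0.
- exact: weight_increment_cofinal.
- by move=> H H0 Hnd Hfin; apply: LX; exact: lorentz_log_step.
- exact: weight_increment_log_lty.
Qed.

Theorem corollary2p5 (R : realType) (X : bfs R)
    (riX : rearrangement_invariant X) (XnLinfty : bfs_set X <> Linfty R) :
  (forall phi : lorentz_weight R,
     lorentz phi `<=` bfs_set X ->
     (\int[leb R]_(t in `]0%R, 1%R[) (ln (1 / t) * derive1 phi t)%:E
        < +oo)%E ->
     finite_variation X (@cesaro_measure R)) /\
  (forall p : R, 0 < p < 1 ->
     Lexp R p `<=` bfs_set X ->
     finite_variation X (@cesaro_measure R)).
Proof.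
split=> [phi|p]; first exact: finite_variation_lorentz.
exact: finite_variation_Lexp.
Qed.
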